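(* Fix $\alpha\in(0,1]$. Let $X_1,\dots,X_n$ be independent nonnegative rewards, each having a continuous recentered IFRA distribution, and let $M=\max_iX_i$ with $0<L_\alpha(M)<\infty$. For every value-oblivious arrival order fixed in advance and every $\varepsilon>0$, there is a threshold policy with payoff $S_\tau$ such that \[ \frac{\mathrm{CVaR}_\alpha(S_\tau)}{\mathrm{CVaR}_\alpha(M)}=\frac{L_\alpha(S_\tau)}{L_\alpha(M)}\ge\rho(\alpha)-\varepsilon. \]
   Context: Rewards arrive one at a time in the fixed order; a threshold policy fixes $\tau\ge0$ in advance, stops at the first observation strictly above $\tau$ (observations equal to $\tau$ may be accepted using independent randomization), and has payoff $S_\tau$ equal to the accepted reward, or $0$ if none is accepted. For a random variable $Z$ with quantile function $Q_Z(u)=\inf\{z:\Pr(Z\le z)\ge u\}$: $L_\alpha(Z)=\int_0^\alpha Q_Z(u)\,du$ and $\mathrm{CVaR}_\alpha(Z)=L_\alpha(Z)/\alpha$ (for $\alpha=1$ this is $\mathbb{E}[Z]$). Continuous recentered IFRA: a nonnegative random variable $X_i$ with cdf $F_i$ has this property if there is an interval $[s_i,u_i)$ with $0\le s_i<u_i\le\infty$ such that (i) $X_i$ is absolutely continuous with positive continuous density on $(s_i,u_i)$; (ii) $F_i(x)=0$ for $x\le s_i$ and, if $u_i<\infty$, $F_i(x)=1$ for $x\ge u_i$; (iii) with $H_i(x)=-\log(1-F_i(x))$, the map $x\mapsto H_i(x)/(x-s_i)$ is nondecreasing on $(s_i,u_i)$. Constants: $\ell(u)=-\log(1-u)$, $\Psi(u)=\int_0^u\ell(v)\,dv=u+(1-u)\log(1-u)$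 with $\Psi(1)=1$. For $\alpha\in(0,1]$, $q_\alpha\in(0,\alpha)$ is the unique solution of $\ell(q_\alpha)=\frac{\alpha-q_\alpha}{1-q_\alpha}$, and \[ \rho_{\mathrm{env}}(\alpha)=\Big[\log\frac{\alpha}{\alpha-q_\alpha}+\frac{\Psi(\alpha)-\Psi(q_\alpha)}{(\alpha-q_\alpha)\ell(q_\alpha)}\Big]^{-1}. \] For $q\in(0,\alpha)$ let $r_\alpha(q)=1-\frac{1-\alpha}{q}$, $\mathcal D_\alpha=\{q\in(0,\alpha):q\le\tfrac12,\ q(1-q)\ge1-\alpha\}$, and for $q\in\mathcal D_\alpha$, \[ G_{\mathrm{cap}}(\alpha,q)=(1-2q)\frac{\ell(q)}{\Psi(\alpha)+\ell(q)-q}+q\frac{\Psi(r_\alpha(q))}{\Psi(\alpha)}. \] $\rho_{\mathrm{cap}}(\alpha)=\sup_{q\in\mathcal D_\alpha}G_{\mathrm{cap}}(\alpha,q)$ if $\mathcal D_\alpha\ne\emptyset$ and $0$ otherwise; $\rho(\alpha)=\max\{\rho_{\mathrm{env}}(\alpha),\rho_{\mathrm{cap}}(\alpha)\}$. *)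

(* Defs.v *)
From HB Require Import structures.
From mathcomp Require Export all_boot all_order all_algebra all_fingroup.
From mathcomp Require Export all_classical all_reals all_analysis.
From mathcomp Require Export measurable_realfun.

Set Implicit Arguments.
Unset Strict Implicit.
Unset Printing Implicit Defensive.

Import Order.TTheory GRing.Theory Num.Theory.
Import numFieldNormedType.Exports.

Local Open Scope classical_set_scope.
Local Open Scope ring_scope.

(* Mutual independence of a finite family of random variables; the product rule
   for subfamilies is the case B i = setT for the remaining indices. *)
Definition independent_RVs (d d' : measure_display) (T : measurableType d)
    (T' : measurableType d') (R : realType) (P : probability T R) (n : nat)
    (X : 'I_n -> {RV P >-> T'}) : Prop :=
  forall B : 'I_n -> set T', (forall i, measurable (B i)) ->
    P (\bigcap_(i in [set: 'I_n]) (X i @^-1` B i)) =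
    (\prod_(i < n) P (X i @^-1` B i))%E.

(* The infimum is taken in \bar R, hence the value +oo at u = 1 when Z is
   unbounded above, and -oo at u = 0. *)
Definition quantile (d : measure_display) (T : measurableType d) (R : realType)
    (P : probability T R) (Z : {RV P >-> R}) (u : R) : \bar R :=
  ereal_inf [set z%:E | z in [set z : R | (u%:E <= cdf Z z)%E]].

Definition lower_tail (d : measure_display) (T : measurableType d)
    (R : realType) (P : probability T R) (alpha : R) (Z : {RV P >-> R}) :
    \bar R :=
  (\int[lebesgue_measure]_(u in `]0%R, alpha[) quantile Z u)%E.

Definition CVaR (d : measure_display) (T : measurableType d)
    (R : realType) (P : probability T R) (alpha : R) (Z : {RV P >-> R}) :
    \bar R :=
  (lower_tail alpha Z / alpha%:E)%E.

Definition cumulative_hazard (d : measure_display) (T : measurableType d)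
    (R : realType) (P : probability T R) (X : {RV P >-> R}) (x : R) : R :=
  - ln (1 - fine (cdf X x)).

Definition is_density (d : measure_display) (T : measurableType d)
    (R : realType) (P : probability T R) (X : {RV P >-> R}) (f : R -> R) :
    Prop :=
  [/\ measurable_fun setT f, (forall x, 0 <= f x) &
      forall A : set R, measurable A ->
        distribution P X A = (\int[lebesgue_measure]_(x in A) (f x)%:E)%E].

Definition continuous_recentered_IFRA (d : measure_display)
    (T : measurableType d) (R : realType) (P : probability T R)
    (X : {RV P >-> R}) : Prop :=
  exists (s : R) (u : \bar R),
    [/\ 0 <= s /\ (s%:E < u)%E,
        exists f : R -> R, is_density X f /\
          (forall x : R, s < x -> (x%:E < u)%E ->
             0 < f x /\ {for x, continuous f}),
        forall x : R, x <= s -> cdf X x = 0%E,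
        forall x : R, (u <= x%:E)%E -> cdf X x = 1%E &
        forall x y : R, s < x -> x <= y -> (y%:E < u)%E ->
          cumulative_hazard X x / (x - s) <= cumulative_hazard X y / (y - s)].

(* The seed is the policy's own source of randomness, used only to decide
   whether an observation equal to tau is accepted; it is independent of the
   rewards because the payoff lives on a product space. *)
Record threshold_policy (R : realType) (n : nat) := ThresholdPolicy {
  tau : R;
  tau_ge0 : 0 <= tau;
  seed_display : measure_display;
  seed : measurableType seed_display;
  seed_law : probability seed R;
  accept_tie : 'I_n -> {RV seed_law >-> bool};
  accept_tie_indep : independent_RVs accept_tie }.

Definition accepts (d : measure_display) (T : measurableType d) (R : realType)
    (P : probability T R) (n : nat) (X : 'I_n -> {RV P >-> R})
    (pol : threshold_policy R n) (w : T * seed pol) (i : 'I_n) : bool :=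
  (tau pol < X i w.1) || ((X i w.1 == tau pol) && accept_tie pol i w.2).

(* The reward arriving at time k is X (sigma k); the payoff is the first
   accepted reward. *)
Definition payoff_fun (d : measure_display) (T : measurableType d)
    (R : realType) (P : probability T R) (n : nat) (X : 'I_n -> {RV P >-> R})
    (sigma : 'S_n) (pol : threshold_policy R n) (w : T * seed pol) : R :=
  head 0 [seq X i w.1 | i <- [seq sigma k | k <- enum 'I_n] & accepts X w i].
Arguments payoff_fun {d T R P n} X sigma pol w.

Lemma measurable_payoff_fun (d : measure_display) (T : measurableType d)
    (R : realType) (P : probability T R) (n : nat) (X : 'I_n -> {RV P >-> R})
    (sigma : 'S_n) (pol : threshold_policy R n) :
  measurable_fun setT (payoff_fun X sigma pol).
Proof.
rewrite /payoff_fun; elim: [seq _ | _ <- _] => [|i s IHs] /=.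
  exact: measurable_cst.
rewrite (_ : (fun w => _) = (fun w => if accepts X w i then X i w.1 else
    head 0 [seq X j w.1 | j <- s & accepts X w j])); last first.
  by apply/funext => w; case: ifP.
have mX : measurable_fun setT (fun w : T * seed pol => X i w.1).
  by apply: measurableT_comp => //; exact: measurable_fst.
apply: measurable_fun_ifT => //; apply: measurable_or.
  exact: measurable_fun_ltr.
apply: measurable_and; first exact: measurable_fun_eqr.
by apply: measurableT_comp => //; exact: measurable_snd.
Qed.

HB.instance Definition _ (d : measure_display) (T : measurableType d)
    (R : realType) (P : probability T R) (n : nat) (X : 'I_n -> {RV P >-> R})
    (sigma : 'S_n) (pol : threshold_policy R n) :=
  isMeasurableFun.Build _ _ _ _ (payoff_fun X sigma pol)
    (@measurable_payoff_fun _ _ _ _ _ X sigma pol).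

Definition payoff (d : measure_display) (T : measurableType d)
    (R : realType) (P : probability T R) (n : nat) (X : 'I_n -> {RV P >-> R})
    (sigma : 'S_n) (pol : threshold_policy R n) :
    {RV (P \x seed_law pol)%E >-> R} :=
  payoff_fun X sigma pol.

(* The default value 0 does not change the maximum of nonnegative rewards. *)
Definition max_reward_fun (d : measure_display) (T : measurableType d)
    (R : realType) (P : probability T R) (n : nat) (X : 'I_n -> {RV P >-> R})
    (w : T) : R :=
  \big[Num.max/0]_(i < n) X i w.

Lemma measurable_max_reward_fun (d : measure_display) (T : measurableType d)
    (R : realType) (P : probability T R) (n : nat)
    (X : 'I_n -> {RV P >-> R}) :
  measurable_fun setT (max_reward_fun X).
Proof.
rewrite /max_reward_fun; elim: (index_enum _) => [|i s IHs].
  by under eq_fun do rewrite big_nil; exact: measurable_cst.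
under eq_fun do rewrite big_cons.
by apply: measurable_maxr => //; exact: measurable_funP.
Qed.

HB.instance Definition _ (d : measure_display) (T : measurableType d)
    (R : realType) (P : probability T R) (n : nat)
    (X : 'I_n -> {RV P >-> R}) :=
  isMeasurableFun.Build _ _ _ _ (max_reward_fun X)
    (@measurable_max_reward_fun _ _ _ _ _ X).

Definition max_reward (d : measure_display) (T : measurableType d)
    (R : realType) (P : probability T R) (n : nat)
    (X : 'I_n -> {RV P >-> R}) : {RV P >-> R} :=
  max_reward_fun X.

Definition ell (R : realType) (u : R) : R := - ln (1 - u).

Definition Psi (R : realType) (u : R) : R :=
  \int[lebesgue_measure]_(v in `[0, u]) ell v.

(* The equation has exactly one solution in ]0, alpha[ when 0 < alpha <= 1. *)
Definition q_env (R : realType) (alpha : R) : R :=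
  xget 0 [set q : R | 0 < q < alpha /\ ell q = (alpha - q) / (1 - q)].

Definition rho_env (R : realType) (alpha : R) : R :=
  let q := q_env alpha in
  (ln (alpha / (alpha - q)) +
   (Psi alpha - Psi q) / ((alpha - q) * ell q))^-1.

Definition r_cap (R : realType) (alpha q : R) : R := 1 - (1 - alpha) / q.

Definition D_cap (R : realType) (alpha : R) : set R :=
  [set q : R | [/\ 0 < q < alpha, q <= 1 / 2 & 1 - alpha <= q * (1 - q)]].

Definition G_cap (R : realType) (alpha q : R) : R :=
  (1 - 2 * q) * (ell q / (Psi alpha + ell q - q)) +
  q * (Psi (r_cap alpha q) / Psi alpha).

Definition rho_cap (R : realType) (alpha : R) : R :=
  if `[< D_cap alpha !=set0 >] then sup (G_cap alpha @` D_cap alpha) else 0.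

Definition rho (R : realType) (alpha : R) : R :=
  Num.max (rho_env alpha) (rho_cap alpha).

(* Main.v *)
(** A recentered IFRA law with nonnegative left endpoint is IFRA at the origin,
    i.e. [P(X > p y) >= P(X > y)^p] for [p] in [(0, 1]], and this is inherited
    by the maximum [M] of independent rewards because [t -> t^p] is concave.
    In terms of the quantile function [Q] of [M], [Q(u) / ell(u)] is
    nonincreasing.

    Take the threshold [tau = Q(q)], so that [P(M <= tau) = q] as [M] has no
    atom there.  The payoff [S] then satisfies [Q_S(u) >= tau] for [u > q],
    hence [L_alpha(S) >= (alpha - q) Q(q)].  If no [v] gave a better value than
    [c], then [Q(v) <= c / (alpha - v)] below the reference level and
    [Q(u) <= Q(q) ell(u) / ell(q)] above it; integrating both bounds yields
    [L_alpha(M) <= c / rho_env].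

    For the cap bound, the disjoint events where [X_i > x] and every other
    reward is at most [tau] give [P(S > x) >= q P(M > x)] for
    [x >= tau] in any arrival order, so that [Q_S(u) >= Q(1 - (1 - u) / q)]; an
    affine change of variables and the monotonicity of [Q / ell] turn this into
    [G_cap]. *)

Require Import Defs.
From mathcomp Require Import ring lra.

Import Order.TTheory GRing.Theory Num.Theory.
Import numFieldNormedType.Exports.
Local Open Scope classical_set_scope.
Local Open Scope ring_scope.

Set Implicit Arguments.
Unset Strict Implicit.
Unset Printing Implicit Defensive.

(** * Powers of survival probabilities *)

(** Since [p^-1 >= 1], the power [p^-1] is convex. This is applied to the [p]-th powers of [x] and
    [y], and the result is raised to the power [p]. *)
Lemma concave_powR (R : realType) (p t x y : R) : 0 < p <= 1 -> 0 <= t <= 1 ->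
  0 <= x -> 0 <= y ->
  t * x `^ p + (1 - t) * y `^ p <= (t * x + (1 - t) * y) `^ p.
Proof.
move=> /andP[p0 p1] /andP[t0 t1] x0 y0.
have pV1 : 1 <= p^-1 by rewrite invf_ge1.
have powK z : 0 <= z -> (z `^ p) `^ p^-1 = z.
  by move=> z0; rewrite -powRrM mulfV ?gt_eqF// powRr1.
have := @convex_powR R _ pV1 (Itv01 t0 t1) (x `^ p) (y `^ p).
rewrite !inE/= !in_itv/= !andbT !powR_ge0 => /(_ erefl erefl).
rewrite !convRE/= !powK// => h.
have tx : 0 <= t * x `^ p + (1 - t) * y `^ p.
  by rewrite addr_ge0// mulr_ge0 ?powR_ge0// subr_ge0.
have -> : t * x `^ p + (1 - t) * y `^ p =
    ((t * x `^ p + (1 - t) * y `^ p) `^ p^-1) `^ p.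
  by rewrite -powRrM mulVf ?gt_eqF// powRr1.
apply: ge0_ler_powR => //; rewrite ?nnegrE ?powR_ge0//; first exact: ltW.
by rewrite addr_ge0 ?mulr_ge0 ?subr_ge0.
Qed.

(** For independent events of probabilities [x] and [y], the union has probability [m] and the
    intersection [x * y]. These have the same sum as [x] and [y] but are more spread out, so a
    concave power has a smaller sum at them. *)
Lemma powR_probabilistic_sum (R : realType) (p x y : R) : 0 < p <= 1 ->
  0 <= x <= 1 -> 0 <= y <= 1 ->
  (1 - (1 - x) * (1 - y)) `^ p <= 1 - (1 - x `^ p) * (1 - y `^ p).
Proof.
move=> p01 /andP[x0 x1] /andP[y0 y1].
have xy0 : 0 <= x * y by rewrite mulr_ge0.
set m := 1 - (1 - x) * (1 - y).
have ym : y <= m by rewrite /m; nra.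
have m_ge : x * y <= m by rewrite /m; nra.
suff h : (x * y) `^ p + m `^ p <= x `^ p + y `^ p.
  by move: h; rewrite powRM//; lra.
(* The weight [t] below divides by [m - x * y]. If this vanishes, [x] and [y] are squeezed and all
   four numbers agree. *)
have [/eqP mE|mxy] := eqVneq (m - x * y) 0.
  rewrite subr_eq0 in mE; move/eqP: mE => mE.
  have xE : x = m by rewrite /m in mE *; nra.
  have yE : y = m by rewrite /m in mE *; nra.
  have -> : x `^ p = m `^ p by congr (_ `^ _).
  have -> : y `^ p = m `^ p by congr (_ `^ _).
  by rewrite -mE.
(* [x] and [y] are convex combinations of [m] and [x * y] with swapped
   weights. *)
pose t := (x - x * y) / (m - x * y).
have d0 : 0 < m - x * y by rewrite lt_def mxy subr_ge0.
have xm : x <= m by rewrite /m; nra.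
have t01 : 0 <= t <= 1.
  rewrite /t divr_ge0 ?(ltW d0)//=; last by rewrite subr_ge0 ler_piMr.
  by rewrite ler_pdivrMr// mul1r lerB.
have t01' : 0 <= 1 - t <= 1 by lra.
have m0 : 0 <= m by lra.
have xE : x = t * m + (1 - t) * (x * y).
  by rewrite /t; field.
have yE : y = (1 - t) * m + (1 - (1 - t)) * (x * y).
  have e : x + y = m + x * y by rewrite /m; ring.
  have e' : y = m + x * y - x by rewrite -e; ring.
  apply: (etrans e').
  by transitivity (m + x * y - (t * m + (1 - t) * (x * y)));
    [rewrite -xE | ring].
have h1 := concave_powR p01 t01 m0 xy0.
have h2 := concave_powR p01 t01' m0 xy0.
by rewrite -xE in h1; rewrite -yE in h2; lra.
Qed.

(** Applied later with [S i] and [S' i] the survival probabilities of reward [i] at [y] and at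
    [p * y]. Induction adds one reward at a time through the two-event inequality. *)
Lemma powR_onem_prod (R : realType) (p : R) (I : Type) (s : seq I)
    (S S' : I -> R) : 0 < p <= 1 ->
  (forall i, 0 <= S i <= 1) -> (forall i, 0 <= S' i <= 1) ->
  (forall i, S i `^ p <= S' i) ->
  (1 - \prod_(i <- s) (1 - S i)) `^ p <= 1 - \prod_(i <- s) (1 - S' i).
Proof.
move=> p01 S01 S'01 SS'.
have p0 : p != 0 by rewrite gt_eqF//; case/andP: p01.
have prod01 (A : I -> R) r : (forall i, 0 <= A i <= 1) ->
    0 <= \prod_(i <- r) (1 - A i) <= 1.
  move=> A01; apply/andP; split.
    by apply: prodr_ge0 => i _; have := A01 i; lra.
  by apply: prodr_ile1 => i _; have := A01 i; lra.
elim: s => [|i s IH]; first by rewrite !big_nil subrr powR0.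
rewrite !big_cons.
set a := \prod_(j <- s) _ in IH *; set b := \prod_(j <- s) (1 - S' j) in IH *.
have a01 : 0 <= a <= 1 by exact: prod01.
have b01 : 0 <= b <= 1 by exact: prod01.
have a01' : 0 <= 1 - a <= 1 by lra.
have := powR_probabilistic_sum p01 (S01 i) a01'.
rewrite (_ : 1 - (1 - a) = a); last by ring.
move=> /le_trans; apply.
have := S'01 i; have := SS' i; have := powR_ge0 (S i) p.
by move: IH; set u := (1 - a) `^ p; set v := S i `^ p => *; nra.
Qed.

(** * Affine change of variables *)

Section affine_substitution.
Context {R : realType}.
Notation mu := (@lebesgue_measure R).

(** The pushforward of [mu] scaled by [a] gives each []c, e]] its length, which characterizes
    Lebesgue measure. *)
Lemma lebesgue_measure_affine (a b : R) (a0 : 0 < a) (A : set R) :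
  measurable A ->
  mu A = (a%:E * mu ((fun x => (a * x + b)%R) @^-1` A))%E.
Proof.
move=> mA.
pose phi : measurableTypeR R -> measurableTypeR R := fun x => a * x + b.
have mphi : measurable_fun setT phi.
  by apply: measurable_funD => //; exact: measurable_funM.
pose nu : {measure set (measurableTypeR R) -> \bar R} :=
  mscale (NngNum (ltW a0)) (pushforward mu phi).
rewrite [LHS](@lebesgue_measure_unique _ (nu mphi))// => _ [[c e] _ <-].
change (mu `]c, e] = a%:E * mu (phi @^-1` `]c, e]))%E.
rewrite (_ : _ @^-1` _ = `](c - b) / a, (e - b) / a]%classic); last first.
  apply/seteqP; split => x /=;
    rewrite !in_itv/= ltr_pdivrMr// ler_pdivlMr// /phi;
    by rewrite ltrBlDr lerBrDr mulrC.
rewrite !lebesgue_measure_itv/= !lte_fin ltr_pM2r ?invr_gt0// ltrD2r.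
case: ifPn; rewrite ?mule0// -!EFinD -EFinM => _; congr EFin.
by field; rewrite gt_eqF.
Qed.

Lemma ge0_integral_affine (a b : R) (D : set R) (f : R -> \bar R) : 0 < a ->
  measurable D -> measurable_fun D f -> (forall x, D x -> 0 <= f x)%E ->
  (\int[mu]_(x in D) f x =
   a%:E * \int[mu]_(x in (fun x => (a * x + b)%R) @^-1` D) f (a * x + b)%R)%E.
Proof.
move=> a0 mD mf f0.
pose phi : measurableTypeR R -> measurableTypeR R := fun x => a * x + b.
have mphi : measurable_fun setT phi.
  by apply: measurable_funD => //; exact: measurable_funM.
pose nu : {measure set (measurableTypeR R) -> \bar R} :=
  mscale (NngNum (ltW a0)) (pushforward mu phi).
rewrite (@eq_measure_integral _ _ _ _ (nu mphi)) => [|A mA _]; last first.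
  exact: (lebesgue_measure_affine b a0 mA).
rewrite ge0_integral_mscale//=; congr (_ * _)%E.
by rewrite ge0_integral_pushforward// => y; rewrite inE => /f0.
Qed.

End affine_substitution.

(** * The functions [ell] and [Psi] *)

Section ell_Psi.
Context {R : realType}.
Notation mu := (@lebesgue_measure R).
Implicit Types a b c u : R.

Lemma Rintegral_itvoo_split (f : R -> R) a b c : a <= b <= c ->
  mu.-integrable `]a, c[ (EFin \o f) ->
  \int[mu]_(x in `]a, c[) f x =
  \int[mu]_(x in `]a, b[) f x + \int[mu]_(x in `]b, c[) f x.
Proof.
have itv0 x : \int[mu]_(y in `]x, x[) f y = 0.
  by rewrite set_itv_ge ?bnd_simp ?ltxx// Rintegral_set0.
move=> /andP[]; rewrite le_eqVlt => /predU1P[<- _ _|ab];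
  first by rewrite itv0 add0r.
rewrite le_eqVlt => /predU1P[<- _|bc intf]; first by rewrite itv0 addr0.
rewrite -(@Rintegral_itvB _ _ (BRight a) (BLeft c) b)//; last first.
  by rewrite bnd_simp ltW.
rewrite (@Rintegral_itv_bndo_bndc _ (BRight a) b).
  by rewrite addrC subrK.
apply: integrableS intf => //.
by apply: subset_itvl; rewrite bnd_simp ltW.
Qed.

Lemma ell0 : ell (0 : R) = 0.
Proof. by rewrite /ell subr0 ln1 oppr0. Qed.

Lemma ell_ge0 u : 0 <= u < 1 -> 0 <= ell u.
Proof.
by move=> /andP[u0 u1]; rewrite /ell oppr_ge0 ln_le0// lerBlDr lerDl.
Qed.

Lemma ell_gt0 u : 0 < u < 1 -> 0 < ell u.
Proof.
by move=> /andP[u0 u1];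
  rewrite /ell oppr_gt0 ln_lt0// subr_gt0 u1/= ltrBlDr ltrDl.
Qed.

Lemma ell_le u v : u <= v < 1 -> ell u <= ell v.
Proof.
move=> /andP[uv v1]; rewrite /ell lerN2 ler_ln ?posrE ?subr_gt0 ?lerB//.
exact: le_lt_trans v1.
Qed.

Lemma measurable_ell : measurable_fun setT (@ell R).
Proof.
apply: measurableT_comp => //; apply: measurableT_comp;
  first exact: measurable_ln.
exact: measurable_funB.
Qed.

Lemma is_derive_lnB a u : u < a ->
  is_derive u 1 (fun x : R => ln (a - x)) (- (a - u)^-1).
Proof.
move=> ua.
have h0 : is_derive u 1 (fun x : R => a - x) (0 - 1) by exact: is_deriveB.
have h1 : is_derive (a - u) 1 (@ln R) (a - u)^-1.
  by apply: is_derive1_ln; rewrite subr_gt0.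
have h := @is_derive1_comp R (@ln R) (fun x => a - x) u _ _ h1 h0.
by apply: is_derive_eq h _; rewrite sub0r mulrN1.
Qed.

Lemma is_derive_ell_primitive u : u < 1 ->
  is_derive u 1 (fun x : R => x + (1 - x) * ln (1 - x)) (ell u).
Proof.
move=> u1.
have h1 := is_derive_lnB u1.
have h0 : is_derive u 1 (fun x : R => 1 - x) (0 - 1) by exact: is_deriveB.
have := is_deriveD (is_derive_id u 1) (is_deriveM h0 h1).
move=> h; apply: is_derive_eq h _.
rewrite /ell /GRing.scale/=.
by rewrite sub0r mulrN mulfV ?mulrN1 ?addrA ?subrr ?add0r// gt_eqF// subr_gt0.
Qed.

Lemma continuous_ell u : u < 1 -> {for u, continuous (@ell R)}.
Proof.
move=> u1; apply: continuousN.
apply: differentiable_continuous; apply/derivable1_diffP.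
by have [] := is_derive_lnB u1.
Qed.

Lemma integral_ell a b : a < b < 1 ->
  (\int[mu]_(x in `[a, b]) (ell x)%:E =
   (b - (1 - b) * ell b - (a - (1 - a) * ell a))%:E)%E.
Proof.
move=> /andP[ab b1].
pose F := fun x : R => x + (1 - x) * ln (1 - x).
have cF x : x < 1 -> {for x, continuous F}.
  move=> x1; apply: differentiable_continuous; apply/derivable1_diffP.
  by have [] := is_derive_ell_primitive x1.
rewrite (@continuous_FTC2 R (@ell R) F)//.
- by rewrite -EFinB /F /ell !mulrN !opprK.
- apply: continuous_in_subspaceT => x; rewrite inE/= in_itv/= => /andP[_ xb].
  exact/continuous_ell/(le_lt_trans xb).
- split.
  + move=> x; rewrite in_itv/= => /andP[_ xb].
    by have [] := is_derive_ell_primitive (lt_trans xb b1).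
  + exact/cvg_at_right_filter/cF/(lt_trans ab).
  + exact/cvg_at_left_filter/cF.
- move=> x; rewrite in_itv/= => /andP[_ xb].
  have h := is_derive_ell_primitive (lt_trans xb b1).
  by rewrite derive1E; exact: derive_val.
Qed.

(** As [ell] is unbounded near 1, the integral is the monotone limit of those over []0, b n]], and
    the explicit primitive bounds each of these by 1. *)
Lemma integrable_ell : mu.-integrable `]0, 1[ (EFin \o @ell R).
Proof.
have mell : measurable_fun (`]0, 1[ : set R) (EFin \o @ell R).
  by apply: measurable_funTS; apply/measurable_EFinP; exact: measurable_ell.
apply/integrableP; split => //.
have -> : (\int[mu]_(x in `]0%R, 1%R[) `|(EFin \o @ell R) x| =
    \int[mu]_(x in `]0%R, 1%R[) (ell x)%:E)%E.
  apply: eq_integral => x; rewrite inE/= in_itv/= => /andP[x0 x1].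
  by rewrite ger0_norm// ell_ge0// (ltW x0).
pose b (n : nat) : R := 1 - n.+1%:R^-1.
pose g (n : nat) (x : R) : \bar R := ((EFin \o @ell R) \_ `]0, b n]) x.
have b1 n : b n < 1 by rewrite /b ltrBlDr ltrDl invr_gt0 ltr0n.
have b0 n : 0 <= b n by rewrite /b subr_ge0 invf_le1 ?ltr0n// ler1n.
have ellE0 (x : R) : x \in `]0, 1[ -> (0 <= (ell x)%:E)%E.
  by rewrite in_itv/= => /andP[x0 x1]; rewrite lee_fin ell_ge0// (ltW x0).
have g0 n x : (`]0, 1[%classic : set R) x -> (0 <= g n x)%E.
  by move=> /= x01; rewrite /g patchE; case: ifP => // _; exact: ellE0.
have mg n : measurable_fun (`]0, 1[ : set R) (g n).
  apply: measurable_funTS.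
  apply/(measurable_restrictT _ _).1 => //.
  by apply: measurable_funTS; apply/measurable_EFinP; exact: measurable_ell.
have ndb : {homo b : m n / (m <= n)%N >-> m <= n}.
  by move=> m n mn; rewrite /b lerB// lef_pV2 ?posrE ?ltr0n// ler_nat.
have ndg (x : R) : (`]0, 1[%classic : set R) x -> nondecreasing_seq (g ^~ x).
  move=> /= x01 m n mn; rewrite /g !patchE.
  case: ifPn => [|_]; last by case: ifPn => // _; exact: ellE0.
  rewrite !inE/= !in_itv/= => /andP[x0 xm].
  by rewrite ifT// inE/= in_itv/= x0 (le_trans xm)// ndb.
have lim (x : R) : x \in (`]0, 1[%classic : set R) ->
  (ell x)%:E = limn (g ^~ x).
  rewrite inE/= => x01; apply/esym/lim_near_cst => //.
  move: x01; rewrite in_itv/= => /andP[x0 x1].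
  have x1' : 0 < 1 - x by rewrite subr_gt0.
  near=> n; rewrite /g patchE ifT// inE/= in_itv/= x0/= /b lerBrDr addrC -lerBrDr.
  apply: ltW; near: n; exact: near_infty_natSinv_lt (PosNum x1').
have -> : (\int[mu]_(x in `]0%R, 1%R[) (ell x)%:E =
    \int[mu]_(x in `]0%R, 1%R[) limn (g ^~ x))%E by exact: eq_integral.
rewrite monotone_convergence//.
apply: (@le_lt_trans _ _ 1%E); last exact: ltry.
apply: lime_le.
  apply: ereal_nondecreasing_is_cvgn => m n mn.
  by apply: ge0_le_integral => //;
    [exact: g0|exact: mg|exact: mg|move=> x x01; exact: (ndg x x01 _ _ mn)].
apply: nearW => n; rewrite /g -integral_mkcondr.
apply: (@le_trans _ _ (\int[mu]_(x in `[0%R, b n]) (ell x)%:E)%E).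
  apply: ge0_subset_integral => //.
  - exact: measurableI.
  - by apply: measurable_funTS; apply/measurable_EFinP; exact: measurable_ell.
  - move=> x /=; rewrite in_itv/= => /andP[x0 xb].
    by rewrite lee_fin ell_ge0// x0 (le_lt_trans xb).
  - by move=> x [_] /=; rewrite !in_itv/= => /andP[x0 ->]; rewrite ltW.
(* [b 0] is 0, where the segment is a single point and [integral_ell] does not apply. *)
have := b0 n; rewrite le_eqVlt => /predU1P[<-|bn0].
  by rewrite set_itv1 integral_set1.
rewrite integral_ell ?bn0 ?b1// lee_fin.
have : 0 <= (1 - b n) * ell (b n).
  by rewrite mulr_ge0// ?ell_ge0 ?b0 ?b1// subr_ge0 ltW.
have := b1 n; rewrite ell0 mulr0 !subr0; lra.
Unshelve. all: by end_near. Qed.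

Lemma integrable_ellS a b : 0 <= a -> b <= 1 ->
  mu.-integrable `]a, b[ (EFin \o @ell R).
Proof.
move=> a0 b1; apply: integrableS integrable_ell => //.
by apply: subset_itvW.
Qed.

(** Open intervals fit the integrals of quantiles, which may be infinite at the endpoints. *)
Lemma Psi_itvoo u : Psi u = \int[mu]_(v in `]0, u[) ell v.
Proof.
rewrite /Psi /Rintegral integral_itv_bndoo//.
by apply: measurable_funTS; apply/measurable_EFinP; exact: measurable_ell.
Qed.

Lemma Rintegral_ell a b : 0 <= a <= b -> b <= 1 ->
  \int[mu]_(v in `]a, b[) ell v = Psi b - Psi a.
Proof.
move=> ab b1; rewrite !Psi_itvoo (Rintegral_itvoo_split ab) ?integrable_ellS//.
by rewrite addrC addKr.
Qed.

Lemma Psi_le a b : 0 <= a <= b -> b <= 1 -> Psi a <= Psi b.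
Proof.
move=> /[dup] ab /andP[a0 _] b1; rewrite -subr_ge0 -Rintegral_ell//.
apply: Rintegral_ge0 => x /=; rewrite in_itv/= => /andP[ax xb].
by rewrite ell_ge0// (le_trans a0 (ltW ax)) (lt_le_trans xb).
Qed.

Lemma Psi_ge0 u : 0 <= u <= 1 -> 0 <= Psi u.
Proof.
move=> /andP[u0 u1]; rewrite Psi_itvoo; apply: Rintegral_ge0 => x /=.
by rewrite in_itv/= => /andP[x0 xu];
  rewrite ell_ge0// (ltW x0) (lt_le_trans xu).
Qed.

Lemma PsiE u : 0 < u < 1 -> Psi u = u - (1 - u) * ell u.
Proof.
move=> u01; rewrite /Psi /Rintegral integral_ell//=.
by rewrite ell0 mulr0 !subr0.
Qed.

End ell_Psi.

(** * Envelopes of IFRA quantile functions *)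

Section envelope.
Context {R : realType}.
Notation mu := (@lebesgue_measure R).
Implicit Types (g : R -> R) (a c q r : R).

(** The last clause is the division-free form of [g / ell] being nonincreasing. The argument 1 is
    excluded because a quantile may be infinite there. *)
Definition IFRA_quantile g : Prop :=
  [/\ forall u : R, 0 < u < 1 -> 0 <= g u,
      forall u v : R, 0 < u <= v -> v < 1 -> g u <= g v &
      forall u v : R, 0 < u <= v -> v < 1 -> g v * ell u <= g u * ell v].

Lemma integrable_itvooS g a b c d : c <= a -> b <= d ->
  mu.-integrable `]c, d[ (EFin \o g) -> mu.-integrable `]a, b[ (EFin \o g).
Proof. by move=> ca bd; apply: integrableS => //; exact: subset_itvW. Qed.

Lemma Rintegral_itvoo_cst a b c : a <= b ->
  \int[mu]_(x in `]a, b[) c = c * (b - a).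
Proof.
move=> ab; rewrite Rintegral_cst//= lebesgue_measure_itv/= lte_fin.
move: ab; rewrite le_eqVlt => /predU1P[->|->//].
by rewrite ltxx subrr.
Qed.

Lemma integrable_itvoo_cst a b c :
  mu.-integrable `]a, b[ (EFin \o (fun=> c)).
Proof.
apply/integrableP; split; first exact: measurable_cst.
rewrite /= integral_cst//= lebesgue_measure_itv/=.
by case: ifPn => _; rewrite ?mule0 -?EFinB -?EFinM ltry.
Qed.

Lemma integrable_itvooZl g a b c : mu.-integrable `]a, b[ (EFin \o g) ->
  mu.-integrable `]a, b[ (EFin \o (fun x => c * g x)).
Proof.
move=> ig.
have h : mu.-integrable `]a, b[ (fun x => c%:E * (EFin \o g) x)%E.
  exact: integrableZl.
exact: h.
Qed.

Lemma IFRA_tail_le g q a : IFRA_quantile g -> 0 < q < a -> a <= 1 ->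
  mu.-integrable `]q, a[ (EFin \o g) ->
  \int[mu]_(x in `]q, a[) g x <= g q / ell q * (Psi a - Psi q).
Proof.
move=> [g0 gnd gI] /andP[q0 qa] a1 ig.
have iell : mu.-integrable `]q, a[ (EFin \o @ell R).
  by rewrite integrable_ellS// ltW.
have qaW : 0 <= q <= a by rewrite !ltW.
rewrite -Rintegral_ell//.
rewrite -RintegralZl//; apply: le_Rintegral => //.
  exact: integrable_itvooZl.
move=> x /=; rewrite in_itv/= => /andP[qx xa].
have x1 : x < 1 by exact: lt_le_trans a1.
have q1 : q < 1 by exact: lt_trans x1.
rewrite mulrAC ler_pdivlMr ?ell_gt0 ?q0//.
by apply: gI => //; rewrite q0 ltW.
Qed.

Lemma IFRA_head_ge g r : IFRA_quantile g -> 0 < r < 1 ->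
  mu.-integrable `]0, r[ (EFin \o g) ->
  g r / ell r * Psi r <= \int[mu]_(x in `]0, r[) g x.
Proof.
move=> [g0 gnd gI] /andP[r0 r1] ig.
have iell : mu.-integrable `]0, r[ (EFin \o @ell R).
  by rewrite integrable_ellS// ltW.
rewrite Psi_itvoo -RintegralZl//; apply: le_Rintegral => //.
  exact: integrable_itvooZl.
move=> x /=; rewrite in_itv/= => /andP[x0 xr].
rewrite mulrAC ler_pdivrMr ?ell_gt0 ?r0//.
by apply: gI => //; rewrite x0 ltW.
Qed.

(** With [k = g r / ell r], [g] dominates [k * ell] on []0, r[] and is dominated by it on []r, a[];
    the ratio of the integrals of [g] and [ell] thus decreases from [r] to [a]. *)
Lemma IFRA_tail_ratio g r a : IFRA_quantile g -> 0 < r <= a -> a <= 1 ->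
  mu.-integrable `]0, a[ (EFin \o g) ->
  (\int[mu]_(x in `]0, a[) g x) * Psi r <=
    (\int[mu]_(x in `]0, r[) g x) * Psi a.
Proof.
move=> gI /andP[r0]; rewrite le_eqVlt => /predU1P[<-//|ra] a1 ig.
have r1 : r < 1 by exact: lt_le_trans a1.
have rP : 0 <= r <= 1 by rewrite !ltW.
have rP' : 0 <= r <= a by rewrite !ltW.
rewrite (@Rintegral_itvoo_split _ _ 0 r a)//.
have ig1 : mu.-integrable `]0, r[ (EFin \o g) by apply: integrable_itvooS ig;
  rewrite // ltW.
have ig2 : mu.-integrable `]r, a[ (EFin \o g) by apply: integrable_itvooS ig;
  rewrite // ltW.
have h1 := @IFRA_tail_le g r a gI.
rewrite r0 ra in h1; have {}h1 := h1 erefl a1 ig2.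
have h2 := @IFRA_head_ge g r gI.
rewrite r0 r1 in h2; have {}h2 := h2 erefl ig1.
have Pr := Psi_ge0 rP; have Pra := Psi_le rP' a1.
move: h1 h2 Pr Pra; set k := g r / ell r; set I := \int[mu]_(x in `]0, r[) _.
set J := \int[mu]_(x in `]r, a[) _ => h1 h2 Pr Pra.
have : J * Psi r <= k * (Psi a - Psi r) * Psi r by rewrite ler_wpM2r.
have : k * Psi r * (Psi a - Psi r) <= I * (Psi a - Psi r).
  by rewrite ler_wpM2r// subr_ge0.
lra.
Qed.

Lemma IFRA_head_le g q : IFRA_quantile g -> 0 < q < 1 ->
  mu.-integrable `]0, q[ (EFin \o g) ->
  \int[mu]_(x in `]0, q[) g x <= g q * q.
Proof.
move=> [g0 gnd gI] /andP[q0 q1] ig.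
rewrite -[X in _ * X]subr0 -Rintegral_itvoo_cst; last exact: ltW.
apply: le_Rintegral => //; first exact: integrable_itvoo_cst.
move=> x /=; rewrite in_itv/= => /andP[x0 xq].
by apply: gnd => //; rewrite x0 ltW.
Qed.

(** Below [q] the bound is the constant [g q], above [q] it is [g q / ell q * ell]. The closed form
    of [Psi q] turns [q * ell q + Psi a - Psi q] into [Psi a + ell q - q]. *)
Lemma IFRA_total_le g q a : IFRA_quantile g -> 0 < q < a -> a <= 1 ->
  mu.-integrable `]0, a[ (EFin \o g) ->
  (\int[mu]_(x in `]0, a[) g x) * ell q <= g q * (Psi a + ell q - q).
Proof.
move=> gI /[dup] qa /andP[q0 qa'] a1 ig.
have q1 : q < 1 by exact: lt_le_trans a1.
have q01 : 0 < q < 1 by rewrite q0.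
have l0 := ell_gt0 q01.
have qaW : 0 <= q <= a by rewrite !ltW.
rewrite (@Rintegral_itvoo_split _ _ 0 q a)//.
have ig1 : mu.-integrable `]0, q[ (EFin \o g) by apply: integrable_itvooS ig;
  rewrite // ltW.
have ig2 : mu.-integrable `]q, a[ (EFin \o g) by apply: integrable_itvooS ig;
  rewrite // ltW.
have := IFRA_tail_le gI qa a1 ig2; have := IFRA_head_le gI q01 ig1.
rewrite mulrAC ler_pdivlMr// (PsiE q01) => h1 h2.
have : (\int[mu]_(x in `]0, q[) g x) * ell q <= g q * q * ell q
  by rewrite ler_pM2r.
move: h2; lra.
Qed.

Lemma continuous_invB a q : q < a ->
  {within `[0, q], continuous (fun x : R => (a - x)^-1)}.
Proof.
move=> qa; apply: continuous_in_subspaceT => x.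
rewrite inE/= in_itv/= => /andP[_ xq].
apply: cvgV; first by rewrite gt_eqF// subr_gt0 (le_lt_trans xq).
by apply: cvgB; [exact: cvg_cst|exact: cvg_id].
Qed.

Lemma integral_invB a q : 0 < q < a ->
  (\int[mu]_(x in `[0%R, q]) ((a - x)^-1)%:E = (ln (a / (a - q)))%:E)%E.
Proof.
move=> /andP[q0 qa].
have a0 : 0 < a by exact: lt_trans qa.
pose F := fun x : R => - ln (a - x).
have dF (x : R) : x < a -> is_derive x 1 F (a - x)^-1.
  move=> xa; have := is_deriveN (is_derive_lnB xa).
  by move=> h; apply: is_derive_eq h _; rewrite opprK.
have cF (x : R) : x < a -> {for x, continuous F}.
  move=> xa; apply: differentiable_continuous; apply/derivable1_diffP.
  by have [] := dF _ xa.
rewrite (@continuous_FTC2 R (fun x => (a - x)^-1) F)//.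
- rewrite -EFinB /F subr0 opprK addrC ln_div// ?posrE//.
  by rewrite subr_gt0.
- exact: continuous_invB.
- split.
  + move=> x; rewrite in_itv/= => /andP[_ xq].
    by have [] := dF _ (lt_trans xq qa).
  + exact/cvg_at_right_filter/cF.
  + exact/cvg_at_left_filter/cF.
- move=> x; rewrite in_itv/= => /andP[_ xq].
  have h := dF _ (lt_trans xq qa).
  by rewrite derive1E; exact: derive_val.
Qed.

(** The logarithm is the integral of [1 / (a - x)] over []0, q[]; the other term is the tail bound
    with [g q] replaced by [c / (a - q)]. *)
Lemma envelope_le g q a c : IFRA_quantile g -> 0 < q < a -> a <= 1 ->
  mu.-integrable `]0, a[ (EFin \o g) ->
  (forall v, 0 < v < a -> (a - v) * g v <= c) ->
  \int[mu]_(x in `]0, a[) g x <=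
  c * (ln (a / (a - q)) + (Psi a - Psi q) / ((a - q) * ell q)).
Proof.
move=> gI /[dup] qa /andP[q0 qa'] a1 ig gc.
have q1 : q < 1 by exact: lt_le_trans a1.
have q01 : 0 < q < 1 by rewrite q0.
have l0 := ell_gt0 q01.
have aq0 : 0 < a - q by rewrite subr_gt0.
have qa2 : 0 <= q <= a by rewrite !ltW.
rewrite (@Rintegral_itvoo_split _ _ 0 q a)// mulrDr.
have ig1 : mu.-integrable `]0, q[ (EFin \o g) by apply: integrable_itvooS ig;
  rewrite // ltW.
have ig2 : mu.-integrable `]q, a[ (EFin \o g) by apply: integrable_itvooS ig;
  rewrite // ltW.
apply: lerD; last first.
  apply: le_trans (IFRA_tail_le gI qa a1 ig2) _.
  rewrite (_ : c * _ = c / (a - q) / ell q * (Psi a - Psi q)); last first.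
    by field; rewrite !gt_eqF.
  rewrite ler_wpM2r ?subr_ge0 ?Psi_le//.
  rewrite ler_pM2r ?invr_gt0// ler_pdivlMr// mulrC.
  exact: gc.
have iV : mu.-integrable `]0, q[ (EFin \o (fun x => (a - x)^-1)).
  apply: (@integrableS _ _ _ mu `[0, q]) => //; first exact: subset_itvW.
  apply: continuous_compact_integrable; first exact: segment_compact.
  exact: continuous_invB.
have -> : ln (a / (a - q)) = \int[mu]_(x in `]0, q[) (a - x)^-1.
  rewrite /Rintegral -(@integral_itv_bndoo _ _ _ _ true false) ?integral_invB//.
  exact: measurable_int iV.
rewrite -RintegralZl//; apply: le_Rintegral => //.
  exact: integrable_itvooZl.
move=> x /=; rewrite in_itv/= => /andP[x0 xq].
rewrite ler_pdivlMr ?subr_gt0 ?(lt_trans xq)// mulrC.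
by apply: gc; rewrite x0 (lt_trans xq).
Qed.

End envelope.

(** * Lower bounds for the integral of a payoff quantile *)

Section lower_bounds.
Context {R : realType}.
Notation mu := (@lebesgue_measure R).
Implicit Types (g : R -> R) (h : R -> \bar R) (a c q r t : R).

Lemma integral_itv_ge_cst h (i : interval R) t : 0 <= t ->
  measurable_fun [set` i] h ->
  (forall u, u \in i -> t%:E <= h u)%E ->
  (t%:E * mu [set` i] <= \int[mu]_(u in [set` i]) h u)%E.
Proof.
move=> t0 mh th; rewrite -integral_cst//.
by apply: ge0_le_integral => // x _; rewrite lee_fin.
Qed.

Lemma integral_ge_step h q a t : 0 <= q <= a -> 0 <= t ->
  measurable_fun setT h -> (forall u : R, 0 < u < a -> (0 <= h u)%E) ->
  (forall u : R, q < u < a -> (t%:E <= h u)%E) ->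
  ((t * (a - q))%:E <= \int[mu]_(u in `]0%R, a[) h u)%E.
Proof.
move=> /andP[q0 qa] t0 mh h0 th.
apply: (@le_trans _ _ (\int[mu]_(u in `]q, a[) h u)%E); last first.
  apply: ge0_subset_integral => //; first exact: measurable_funTS.
  exact: subset_itvW.
have := @integral_itv_ge_cst h `]q, a[ t t0 (measurable_funTS mh).
rewrite lebesgue_measure_itv/= lte_fin => hh; apply: le_trans (hh _).
  move: qa; rewrite le_eqVlt => /predU1P[->|->];
    first by rewrite ltxx subrr mulr0 mule0.
  by rewrite -EFinB -EFinM.
by move=> u; rewrite in_itv/=; exact: th.
Qed.

(** Here [h] plays the payoff quantile: nothing is kept on []0, q[], the threshold value on []q,
    b[], and the rescaled quantile on []b, a[]. *)
Lemma integral_ge_cap g h q a : IFRA_quantile g -> measurable_fun setT g ->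
  0 < q < a -> a <= 1 -> 1 - a <= q * (1 - q) ->
  mu.-integrable `]0, a[ (EFin \o g) ->
  measurable_fun setT h -> (forall u : R, 0 < u < a -> (0 <= h u)%E) ->
  (forall u : R, q < u < a -> ((g q)%:E <= h u)%E) ->
  (forall u : R, 1 - q * (1 - q) < u < a -> ((g (r_cap u q))%:E <= h u)%E) ->
  (((1 - 2 * q) * g q + q * \int[mu]_(x in `]0, r_cap a q[) g x)%:E <=
   \int[mu]_(u in `]0%R, a[) h u)%E.
Proof.
move=> gI mg /[dup] qa /andP[q0 qa'] a1 D ig mh h0 h1 h2.
have q1 : q < 1 by exact: lt_le_trans a1.
have q01 : 0 < q < 1 by rewrite q0.
have gq0 : 0 <= g q by have [g0 _ _] := gI; exact: g0.
(* [b] is the crossover level, where [r_cap b q = q]; the cap condition says exactly that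
   [b <= a]. *)
pose b := 1 - q * (1 - q).
have qb : q <= b by rewrite /b; nra.
have ba : b <= a by rewrite /b; lra.
pose r := r_cap a q.
have qr : q <= r by rewrite /r /r_cap lerBrDr -lerBrDl ler_pdivrMr// mulrC.
have ra : r <= a.
  rewrite /r /r_cap lerBlDr -lerBlDl ler_pdivlMr//.
  by rewrite ler_piMr ?subr_ge0// ltW.
have ig1 : mu.-integrable `]0, r[ (EFin \o g) by exact: integrable_itvooS ig.
have ig2 : mu.-integrable `]0, q[ (EFin \o g).
  by apply: integrable_itvooS ig => //; rewrite ltW.
have ig3 : mu.-integrable `]q, r[ (EFin \o g).
  by apply: integrable_itvooS ig => //; rewrite ltW.
have qrW : 0 <= q <= r by rewrite ltW.
have hI := IFRA_head_le gI q01 ig2.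
rewrite -/r (Rintegral_itvoo_split qrW ig1).
have step1 : (((b - q) * g q)%:E <= \int[mu]_(u in `]q, b[) h u)%E.
  have := @integral_itv_ge_cst h `]q, b[ (g q) gq0 (measurable_funTS mh).
  rewrite lebesgue_measure_itv/= lte_fin => hh; apply: le_trans (hh _).
    move: qb; rewrite le_eqVlt => /predU1P[->|->].
      by rewrite ltxx subrr mul0r mule0.
    by rewrite -EFinB -EFinM mulrC.
  move=> u; rewrite in_itv/= => /andP[qu ub].
  by apply: h1; rewrite qu (lt_le_trans ub).
have rE u : r_cap u q = q^-1 * u + (1 - q^-1).
  by rewrite /r_cap; field; rewrite gt_eqF.
have r1 : r <= 1 by exact: le_trans a1.
have gqr0 x : `]q, r[%classic x -> (0 <= (g x)%:E)%E.
  rewrite /= in_itv/= => /andP[qx xr]; rewrite lee_fin.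
  by have [g0 _ _] := gI; apply: g0; rewrite (lt_trans q0)//= (lt_le_trans xr).
have step2 : ((q * \int[mu]_(x in `]q, r[) g x)%:E <=
    \int[mu]_(u in `]b, a[) h u)%E.
  rewrite EFinM fineK; last exact: integrable_fin_num.
  rewrite (@ge0_integral_affine R q^-1 (1 - q^-1) `]q, r[ (EFin \o g))
    ?invr_gt0//; last first.
    by apply: measurable_funTS; exact/measurable_EFinP.
  rewrite muleA -EFinM mulfV ?gt_eqF// mul1e.
  rewrite (_ : _ @^-1` _ = `]b, a[%classic); last first.
    apply/seteqP; split => x /=; rewrite !in_itv/= -rE /r_cap /b /r /r_cap;
      rewrite ltrBrDr -ltrBrDl ltr_pdivrMr// ltrD2l ltrN2 ltr_pM2r ?invr_gt0//;
      by rewrite ltrD2l ltrN2 (mulrC (1 - q)) ltrBlDr -ltrBlDl.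
  apply: ge0_le_integral => //.
  - move=> x xba; apply: gqr0; move: xba.
    rewrite /= !in_itv/= -rE /r_cap /b /r /r_cap => /andP[bx xa].
    rewrite ltrBrDr -ltrBrDl ltr_pdivrMr// ltrD2l ltrN2 ltr_pM2r ?invr_gt0//.
    by rewrite ltrD2l ltrN2 (mulrC (1 - q)) ltrBlDr -ltrBlDl bx xa.
  - apply: measurable_funTS; apply/measurable_EFinP;
    apply: measurableT_comp => //.
    by apply: measurable_funD => //; exact: measurable_funM.
  - exact: measurable_funTS.
  - by move=> u; rewrite /= in_itv/= => ub; rewrite -rE; exact: h2.
have sub : (`]q, b[ `|` `]b, a[ : set R) `<=` `]0, a[.
  move=> x [] /=; rewrite !in_itv/= => /andP[x1 x2].
    by rewrite (lt_trans q0)//= (lt_le_trans x2).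
  by rewrite x2 andbT (lt_trans q0)// (le_lt_trans qb).
apply: (@le_trans _ _ (\int[mu]_(u in `]q, b[ `|` `]b, a[) h u)%E); last first.
  apply: ge0_subset_integral => //; first exact: measurableU.
    exact: measurable_funTS.
rewrite ge0_integral_setU//=; last 3 first.
- exact: measurable_funTS.
- by move=> x /sub; exact: h0.
- rewrite disj_set2E; apply/eqP; rewrite -subset0 => x [] /=.
  by rewrite !in_itv/= => /andP[_ /ltW x1] /andP[x2 _]; rewrite ltNge x1 in x2.
apply: le_trans (leeD step1 step2); rewrite -EFinD lee_fin mulrDr.
(* Since [b - q = 1 - 2 * q + q ^ 2], the surplus [q ^ 2 * g q] pays for the missing integral over
   []0, q[]. *)
have : q * (\int[mu]_(x in `]0, q[) g x) <= q * (g q * q) by rewrite ler_pM2l.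
have alg (t I J : R) : q * I <= q * (t * q) ->
    (1 - 2 * q) * t + (q * I + q * J) <= (b - q) * t + q * J.
  by rewrite /b; clear; lra.
exact: alg.
Qed.

(** The two summands of [G_cap] are matched separately: [IFRA_total_le] weighted by
    [1 - 2 * q >= 0], and [IFRA_tail_ratio] at [r]. *)
Lemma G_cap_le g q a : IFRA_quantile g -> 0 < q < a -> a <= 1 ->
  q <= 1 / 2 -> 1 - a <= q * (1 - q) ->
  mu.-integrable `]0, a[ (EFin \o g) ->
  G_cap a q * \int[mu]_(x in `]0, a[) g x <=
  (1 - 2 * q) * g q + q * \int[mu]_(x in `]0, r_cap a q[) g x.
Proof.
move=> gI /[dup] qa /andP[q0 qa'] a1 q12 D ig.
have q1 : q < 1 by exact: lt_le_trans a1.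
have q01 : 0 < q < 1 by rewrite q0.
have l0 := ell_gt0 q01.
have qaW : 0 <= q <= a by rewrite !ltW.
have a01 : 0 <= a <= 1 by rewrite (le_trans (ltW q0) (ltW qa')).
pose r := r_cap a q.
have qr : q <= r by rewrite /r /r_cap lerBrDr -lerBrDl ler_pdivrMr// mulrC.
have ra : r <= a.
  rewrite /r /r_cap lerBlDr -lerBlDl ler_pdivlMr//.
  by rewrite ler_piMr ?subr_ge0// ltW.
have r0a : 0 < r <= a by rewrite (lt_le_trans q0).
rewrite /G_cap mulrDl; apply: lerD.
  rewrite -mulrA ler_wpM2l//; first by lra.
  have d0 : 0 < Psi a + ell q - q.
    (* Since [Psi a >= Psi q = q - (1 - q) * ell q], the denominator is at least [q * ell q]. *)
    have := Psi_le qaW a1; rewrite (PsiE q01) => ?.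
    have : 0 < q * ell q by rewrite mulr_gt0.
    lra.
  rewrite mulrAC ler_pdivrMr// mulrC.
  exact: IFRA_total_le.
rewrite -mulrA ler_pM2l// -/r.
have := IFRA_tail_ratio gI r0a a1 ig.
(* Were [Psi a] zero, the quotient would be 0 by convention, leaving only the nonnegativity of an
   integral. *)
have := Psi_ge0 a01; rewrite le_eqVlt => /predU1P[<- _|P0 h].
  rewrite invr0 mulr0 mul0r; apply: Rintegral_ge0 => x /=.
  rewrite in_itv/= => /andP[x0 xr]; have [g0 _ _] := gI; apply: g0.
  by rewrite x0 (lt_le_trans xr)// (le_trans ra).
by rewrite mulrAC ler_pdivrMr// mulrC.
Qed.

End lower_bounds.

(** * Quantiles *)

(** Preimages of upper rays under a monotone map are intervals. *)
Lemma nondecreasing_emeasurable (R : realType) (f : R -> \bar R) :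
  {homo f : x y / x <= y >-> (x <= y)%E} -> measurable_fun setT f.
Proof.
move=> fnd mT; apply: (measurability _ (ErealGenCInfty.measurableE R)) => //.
move=> /= _ [_ [r ->] <-].
apply: measurableI => //; apply: is_interval_measurable => s t/=.
rewrite !in_itv/= !andbT => fs ft u /andP[su ut].
by rewrite in_itv/= andbT (le_trans fs)// fnd.
Qed.

Section quantile_theory.
Context (d : measure_display) (T : measurableType d) (R : realType).
Context (P : probability T R) (Z : {RV P >-> R}).
Implicit Types u x z : R.

Lemma quantile_le u z : (u%:E <= cdf Z z)%E -> (quantile Z u <= z%:E)%E.
Proof. by move=> uz; apply: ereal_inf_lbound; exists z. Qed.

Lemma le_quantile u x : (forall z, (u%:E <= cdf Z z)%E -> x <= z) ->
  (x%:E <= quantile Z u)%E.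
Proof.
by move=> h; apply: le_ereal_inf_tmp => _ [z uz <-]; rewrite lee_fin; exact: h.
Qed.

Lemma quantile_nondecreasing : {homo quantile Z : u v / u <= v >-> (u <= v)%E}.
Proof.
move=> u v uv; apply: ereal_inf_le_tmp => _ [z /= vz <-]; exists z => //=.
by apply: le_trans vz; rewrite lee_fin.
Qed.

Lemma measurable_quantile : measurable_fun setT (quantile Z).
Proof.
apply: nondecreasing_emeasurable => u v; exact: quantile_nondecreasing.
Qed.

Lemma cdf_lt0 z : (forall w, 0 <= Z w) -> z < 0 -> cdf Z z = 0%E.
Proof.
move=> Z0 z0; rewrite /cdf /distribution /pushforward.
rewrite (_ : _ @^-1` _ = set0) ?measure0//.
apply/seteqP; split => // w /=; rewrite in_itv/= leNgt => /negP; apply.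
exact: lt_le_trans (Z0 w).
Qed.

Lemma quantile_ge0 u : (forall w, 0 <= Z w) -> 0 < u -> (0 <= quantile Z u)%E.
Proof.
move=> Z0 u0; apply: le_quantile => z uz; rewrite leNgt; apply/negP => z0.
by move: uz; rewrite cdf_lt0// lee_fin leNgt u0.
Qed.

Lemma exists_cdf_ge u : u < 1 -> exists z, (u%:E <= cdf Z z)%E.
Proof.
move=> u1.
have h : nbhs (1 : \bar R)%E [set y : \bar R | (u%:E < y)%E].
  by apply: open_nbhs_nbhs; split;
    [exact: open_ereal_gt_ereal|rewrite /= lte_fin].
have h' : \forall z \near +oo%R, (u%:E < cdf Z z)%E := @cvg_cdfy1 _ _ _ P Z _ h.
by have [z uz] := filter_ex h'; exists z; exact: ltW.
Qed.

Lemma quantile_fin_num u : (forall w, 0 <= Z w) -> 0 < u < 1 ->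
  quantile Z u \is a fin_num.
Proof.
move=> Z0 /andP[u0 u1]; rewrite ge0_fin_numE ?quantile_ge0//.
have [z uz] := exists_cdf_ge u1.
by apply: le_lt_trans (quantile_le uz) _; rewrite ltry.
Qed.

Lemma cdf_fin_num z : cdf Z z \is a fin_num.
Proof. exact: fin_num_measure. Qed.

(** Right continuity of the cdf makes the infimum defining the quantile attained. *)
Lemma le_cdf_quantile u x : quantile Z u = x%:E -> (u%:E <= cdf Z x)%E.
Proof.
move=> Qx.
have h : cdf Z z @[z --> x^'+] --> cdf Z x by exact: cdf_right_continuous.
rewrite -(cvg_lim _ h)//; apply: lime_ge; first by apply/cvg_ex;
  exists (cdf Z x).
near=> z.
have : (quantile Z u < z%:E)%E by rewrite Qx lte_fin; near: z;
  exact: nbhs_right_gt.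
move=> /ereal_inf_lt[_ [y /= uy <-]]; rewrite lte_fin => yz.
by apply: le_trans uy _; apply: cdf_nondecreasing; exact: ltW.
Unshelve. all: by end_near. Qed.

(** No point below [x] has cdf at least [u]; continuity from below along [x - n.+1%:R^-1] passes
    this to the open half-line. *)
Lemma probability_lt_quantile_le u x : quantile Z u = x%:E ->
  (P (Z @^-1` `]-oo, x[) <= u%:E)%E.
Proof.
move=> Qx.
pose F (n : nat) := Z @^-1` `]-oo, x - n.+1%:R^-1].
have mF n : measurable (F n) by exact: measurable_funPTI.
have -> : Z @^-1` `]-oo, x[ = \bigcup_n F n.
  apply/seteqP; split => w /=; rewrite ?in_itv/=.
    rewrite -subr_gt0 => xw; have [n] := ltr_add_invr xw.
    by rewrite add0r => nx; exists n => //=;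
      rewrite /F/= in_itv/= lerBrDr -lerBrDl ltW.
  move=> [n _]; rewrite /F/= in_itv/= => h; apply: le_lt_trans h _.
  by rewrite ltrBlDr ltrDl invr_gt0.
have ndF : nondecreasing_seq F.
  move=> m n mn; apply/subsetPset => w; rewrite /F/= !in_itv/= => h.
  apply: le_trans h _; rewrite lerD2l lerN2 lef_pV2 ?posrE//.
  by rewrite ler_nat.
have mU : measurable (\bigcup_n F n) by exact: bigcup_measurable.
have h := nondecreasing_cvg_mu (mu := P) mF mU ndF.
rewrite -(cvg_lim _ h)//; apply: lime_le.
  by apply/cvg_ex; exists (P (\bigcup_n F n)); exact: h.
apply: nearW => n /=; rewrite leNgt; apply/negP => un.
have : (quantile Z u <= (x - n.+1%:R^-1)%:E)%E by apply: quantile_le;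
  exact: ltW.
by rewrite Qx lee_fin leNgt ltrBlDr ltrDl invr_gt0 ltr0n.
Qed.

End quantile_theory.

(** * The maximum of independent IFRA rewards *)

Section IFRA_rewards.
Context (d : measure_display) (T : measurableType d) (R : realType).
Context (P : probability T R).

Lemma fine_cdf_itv01 (Z : {RV P >-> R}) (z : R) : 0 <= fine (cdf Z z) <= 1.
Proof.
by rewrite fine_ge0 ?cdf_ge0//= -lee_fin fineK ?cdf_fin_num ?cdf_le1.
Qed.

Lemma fine_cdf_le (Z : {RV P >-> R}) (x y : R) : x <= y ->
  fine (cdf Z x) <= fine (cdf Z y).
Proof. by move=> xy; rewrite fine_le ?cdf_fin_num// cdf_nondecreasing. Qed.

(** Inside the support, the monotone hazard slope bounds the hazard at [p * y] by
    [(p * y - s) / (y - s)] times that at [y]. This factor is at most [p] because [s >= 0]. Outside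
    the support one of the two survival probabilities is trivial. *)
Lemma IFRA_survival (X : {RV P >-> R}) (p y : R) :
  continuous_recentered_IFRA X -> 0 < p <= 1 -> 0 <= y ->
  (1 - fine (cdf X y)) `^ p <= 1 - fine (cdf X (p * y)).
Proof.
move=> [s [u [[s0 su] _ Fs Fu IF]]] /andP[p0 p1] y0.
have F01 := fine_cdf_itv01 X y.
have S0 : 0 <= 1 - fine (cdf X y) by lra.
have S1 : 1 - fine (cdf X y) <= 1 by lra.
have [pys|spy] := leP (p * y) s.
  rewrite (Fs _ pys)/= subr0.
  apply: (@le_trans _ _ (1 `^ p)); last by rewrite powR1.
  by apply: ge0_ler_powR; rewrite ?nnegrE// ltW.
have [uy|yu] := leP u y%:E.
  rewrite (Fu _ uy)/= subrr powR0 ?gt_eqF// subr_ge0.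
  by have /andP[] := fine_cdf_itv01 X (p * y).
have pyy : p * y <= y by rewrite ler_piMl.
have sy : s < y by exact: lt_le_trans pyy.
have := IF _ _ spy pyy yu.
rewrite ler_pdivrMr ?subr_gt0// /cumulative_hazard.
have FF := fine_cdf_le X pyy.
set A := fine (cdf X y) in F01 S0 S1 FF *;
  set B := fine (cdf X (p * y)) in FF *.
(* If survival vanishes at [y], the hazard is meaningless since [ln 0] is 0, so this case avoids
   logarithms. *)
move: S0; rewrite le_eqVlt => /predU1P[<- _|S0 h].
  by rewrite powR0 ?gt_eqF// subr_ge0; lra.
rewrite -ler_ln ?posrE ?powR_gt0//; last by lra.
rewrite ln_powR -lerN2 (le_trans h)//.
have lnA : 0 <= - ln (1 - A) by rewrite oppr_ge0 ln_le0.
rewrite -mulrA -mulrN mulrC ler_wpM2r// mulrC ler_pdivrMr ?subr_gt0//.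
by rewrite mulrBr lerB// ler_piMl.
Qed.

(** A law with a density has no atoms. *)
Lemma IFRA_cdf_lt (X : {RV P >-> R}) (x : R) :
  continuous_recentered_IFRA X -> P (X @^-1` `]-oo, x[) = cdf X x.
Proof.
move=> [s [u [_ [f [[mf f0 Xf] _]] _ _ _]]].
rewrite /cdf -[LHS]/(distribution P X `]-oo, x[).
rewrite -(@setUitv1 _ _ -oo%O x true)// measureU//; last first.
  by apply/seteqP; split => // z [] /=; rewrite in_itv/= => /[swap] ->;
    rewrite ltxx.
rewrite [X in (_ + X)%E](_ : _ = 0%E) ?adde0//.
by rewrite /= Xf// integral_set1.
Qed.

Section maximum.
Context (n : nat) (X : 'I_n -> {RV P >-> R}).
Context (X_indep : independent_RVs X).

(** The condition [0 <= x] accounts for the default value 0 in the maximum. *)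
Lemma cdf_max_reward (x : R) : 0 <= x ->
  cdf (max_reward X) x = (\prod_(i < n) cdf (X i) x)%E.
Proof.
move=> x0; rewrite -(X_indep (B := fun=> `]-oo, x]%classic))//.
congr (P _); apply/seteqP; split => w /=; rewrite ?in_itv/=.
  by move=> /bigmax_leP[_ h] i _ /=; rewrite in_itv/= h.
move=> h; apply/bigmax_leP; split => // i _.
by have := h i I; rewrite /= in_itv/=.
Qed.

Lemma probability_max_reward_lt (x : R) : 0 < x ->
  P (max_reward X @^-1` `]-oo, x[) = (\prod_(i < n) P (X i @^-1` `]-oo, x[))%E.
Proof.
move=> x0; rewrite -(X_indep (B := fun=> `]-oo, x[%classic))//.
congr (P _); apply/seteqP; split => w /=; rewrite ?in_itv/=.
  by move=> /bigmax_ltP[_ h] i _ /=; rewrite in_itv/= h.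
move=> h; apply/bigmax_ltP; split => // i _.
by have := h i I; rewrite /= in_itv/=.
Qed.

Lemma fine_cdf_max_reward (x : R) : 0 <= x ->
  fine (cdf (max_reward X) x) = \prod_(i < n) fine (cdf (X i) x).
Proof.
move=> x0; rewrite cdf_max_reward// -[RHS]/(fine (_)%:E) -prodEFin.
by congr fine; apply: eq_bigr => i _; rewrite fineK ?cdf_fin_num.
Qed.

Lemma max_reward_ge0 w : 0 <= max_reward X w.
Proof. exact: bigmax_ge_id. Qed.

Context (X_IFRA : forall i, continuous_recentered_IFRA (X i)).

Lemma max_reward_survival (p y : R) : 0 < p <= 1 -> 0 <= y ->
  (1 - fine (cdf (max_reward X) y)) `^ p <=
  1 - fine (cdf (max_reward X) (p * y)).
Proof.
move=> p01 y0; rewrite !fine_cdf_max_reward//; last first.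
  by rewrite mulr_ge0//; case/andP: p01 => /ltW.
have pE (x : R) : \prod_(i < n) fine (cdf (X i) x) =
    \prod_(i < n) (1 - (1 - fine (cdf (X i) x))).
  by apply: eq_bigr => i _; rewrite subKr.
rewrite !pE; apply: powR_onem_prod => // i.
- by have := fine_cdf_itv01 (X i) y; lra.
- by have := fine_cdf_itv01 (X i) (p * y); lra.
- exact: IFRA_survival.
Qed.

Lemma max_reward_quantileE (u : R) : 0 < u < 1 ->
  quantile (max_reward X) u = (fine (quantile (max_reward X) u))%:E.
Proof.
by move=> u01; rewrite fineK// quantile_fin_num//; exact: max_reward_ge0.
Qed.

Lemma IFRA_quantile_max_reward :
  IFRA_quantile (fun u => fine (quantile (max_reward X) u)).
Proof.
split.
- move=> u /andP[u0 u1]; apply: fine_ge0; apply: quantile_ge0 => //.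
  exact: max_reward_ge0.
- move=> u v /andP[u0 uv] v1.
  rewrite -lee_fin -!max_reward_quantileE ?quantile_nondecreasing// ?u0
    ?(le_lt_trans uv)//.
  by rewrite (lt_le_trans u0).
- move=> u v /andP[u0 uv] v1.
  have u01 : 0 < u < 1 by rewrite u0 (le_lt_trans uv).
  have v01 : 0 < v < 1 by rewrite v1 (lt_le_trans u0).
  have lu := ell_gt0 u01; have lv := ell_gt0 v01.
  set x := fine (quantile _ u).
  have x0 : 0 <= x by apply: fine_ge0; apply: quantile_ge0 => //;
    exact: max_reward_ge0.
  rewrite -ler_pdivlMr//.
  (* [y] is the bound claimed for the quantile at [v], and [p] is chosen so that [(1 - v)] to the
     power [p] is [1 - u] and [p * y = x]. A cdf below [v] at [y] would then force survival at [x]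
     above [1 - u]. *)
  set y := x * ell v / ell u.
  have y0 : 0 <= y by rewrite divr_ge0 ?mulr_ge0// ltW.
  pose p := ell u / ell v.
  have p01 : 0 < p <= 1.
    by rewrite divr_gt0//= ler_pdivrMr// mul1r ell_le// uv.
  have py : p * y = x by rewrite /p /y; field; rewrite !gt_eqF.
  rewrite -lee_fin -max_reward_quantileE//.
  apply: quantile_le.
  have := le_cdf_quantile (max_reward_quantileE u01).
  rewrite -/x -[cdf _ x]fineK ?cdf_fin_num// lee_fin => ux.
  rewrite -[cdf _ y]fineK ?cdf_fin_num// lee_fin leNgt; apply/negP => yv.
  have := max_reward_survival p01 y0; rewrite py => h.
  have : (1 - v) `^ p < (1 - fine (cdf (max_reward X) y)) `^ p.
    have /andP[_ v1'] := v01.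
    apply: gt0_ltr_powR; rewrite ?nnegrE//; first by case/andP: p01.
    + by rewrite subr_ge0 ltW.
    + by rewrite subr_ge0; case/andP: (fine_cdf_itv01 (max_reward X) y).
    + by rewrite ltrD2l ltrN2.
  have -> : (1 - v) `^ p = 1 - u.
    rewrite /powR ifF; last by rewrite gt_eqF// subr_gt0.
    rewrite (_ : p * _ = ln (1 - u)) ?lnK ?posrE ?subr_gt0//.
      by case/andP: u01.
    by rewrite /p /ell; field; rewrite -oppr_eq0 gt_eqF.
  by move=> h'; move: (lt_le_trans h' h); rewrite ltNge lerD2l lerN2 ux.
Qed.

(** Without atoms, [cdf x = P(M < x) <= u <= cdf x]. The product formula for [M < x] asks for
    [x > 0], which holds because a reward has no mass on nonpositive values. *)
Lemma cdf_max_reward_quantile (u x : R) : (0 < n)%N -> 0 < u ->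
  quantile (max_reward X) u = x%:E -> fine (cdf (max_reward X) x) = u.
Proof.
move=> n0 u0 Qx.
have ux := le_cdf_quantile Qx.
have cdf0 : cdf (max_reward X) 0 = 0%E.
  rewrite cdf_max_reward// (bigD1 (Ordinal n0))//=.
  have [s [t [[s0 _] _ Fs _ _]]] := X_IFRA (Ordinal n0).
  by rewrite Fs// mul0e.
have x0 : 0 < x.
  rewrite ltNge; apply/negP => x0.
  have := le_trans ux (cdf_nondecreasing (max_reward X) x0).
  by rewrite cdf0 lee_fin leNgt u0.
apply/eqP; rewrite eq_le -2!lee_fin fineK ?cdf_fin_num// ux andbT.
apply: le_trans (probability_lt_quantile_le Qx).
rewrite probability_max_reward_lt// cdf_max_reward; last exact: ltW.
by under [leRHS]eq_bigr do rewrite IFRA_cdf_lt//.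
Qed.

End maximum.
End IFRA_rewards.

(** * Payoff of a threshold policy *)

Section strict_policy.
Context {R : realType} (n : nat).

(* The thresholds used below are hit with probability zero, so the seed can be
   trivial. *)
Definition never_accept_tie (i : 'I_n) : {RV
  (\d_tt : probability unit R) >-> bool} :=
  cst false.

(** Under a Dirac law both sides are the indicator that [false] lies in every [B i]. *)
Lemma never_accept_tie_indep : independent_RVs never_accept_tie.
Proof.
move=> B mB.
have E i : (\d_tt : probability unit R) (never_accept_tie i @^-1` B i) =
    ((false \in B i)%:R)%:E.
  by rewrite /= diracE; congr ((nat_of_bool _)%:R%:E); apply/idP/idP;
    rewrite !inE.
under eq_bigr do rewrite E.
rewrite /= diracE prodEFin; congr EFin.
have [/asboolP h|/asboolPn/existsNP[i Bi]] := boolP `[< forall i, B i false >].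
  rewrite mem_set; last by move=> i _; exact: h.
  by rewrite big1// => i _; rewrite mem_set.
rewrite memNset; last by move=> h; apply: Bi; exact: (h i).
by rewrite (bigD1 i)//= memNset// mul0r.
Qed.

Definition strict_policy (t : R) (t0 : 0 <= t) : threshold_policy R n :=
  ThresholdPolicy t0 never_accept_tie_indep.

End strict_policy.

(** The union bound for independent events of probabilities [a i]. *)
Lemma onem_prod_le_sum (R : realType) (I : Type) (s : seq I) (a : I -> R) :
  (forall i, 0 <= a i <= 1) ->
    1 - \prod_(i <- s) (1 - a i) <= \sum_(i <- s) a i.
Proof.
move=> a01.
suff [] : 0 <= \prod_(i <- s) (1 - a i) <= 1 /\
    1 - \prod_(i <- s) (1 - a i) <= \sum_(i <- s) a i by [].
elim: s => [|i s [h1 h2]]; first by rewrite !big_nil subrr lexx ler01.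
by rewrite !big_cons; have := a01 i; split; nra.
Qed.

Section payoff.
Context (d : measure_display) (T : measurableType d) (R : realType).
Context (P : probability T R) (n : nat) (X : 'I_n -> {RV P >-> R}).
Context (sigma : 'S_n) (t : R) (t0 : 0 <= t).
Notation pol := (strict_policy n t0).
Notation S := (payoff X sigma pol).

Lemma acceptsE (w : T * seed pol) i : accepts X w i = (t < X i w.1).
Proof. by rewrite /accepts/= andbF orbF. Qed.

(** The arrival order disappears here: [sigma] visits every index, and the bounds below only need
    that the payoff is some reward above [t], or 0 when there is none. *)
Lemma payoffP (w : T * seed pol) :
  (exists2 k, t < X k w.1 & S w = X k w.1) \/
  (forall i, X i w.1 <= t) /\ S w = 0.
Proof.
rewrite /= /payoff_fun.
set s := [seq sigma k | k <- enum 'I_n].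
have sP i : i \in s.
  by apply/mapP; exists (sigma^-1 i)%g; rewrite ?mem_enum// permKV.
case: (seq.filter _ s) (fun i => seq.mem_filter (accepts X w) i s) => [|k r] fs.
  right; split=> // i; rewrite leNgt; apply/negP => ti.
  by have := fs i; rewrite sP acceptsE ti.
left; exists k => //.
by have := fs k; rewrite inE eqxx/= acceptsE => /esym/andP[].
Qed.

Context (X_ge0 : forall i w, 0 <= X i w).

Lemma payoff_ge0 w : 0 <= S w.
Proof. by have [[k _ ->//]|[_ ->]] := payoffP w. Qed.

Lemma product_seed_law (A : set T) : measurable A ->
  (P \x seed_law pol)%E (A `*` setT) = P A.
Proof.
by move=> mA;
  rewrite product_measure1E// [X in (_ * X)%E]probability_setT mule1.
Qed.

(** A payoff below the threshold is not an accepted reward, so every reward is at most [t]. *)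
Lemma cdf_payoff_le (z : R) : z < t ->
  (cdf S z <= cdf (max_reward X) t)%E.
Proof.
move=> zt; rewrite /cdf /distribution /pushforward -product_seed_law;
  last first.
  exact: measurable_funPTI.
apply: le_measure; rewrite ?inE.
- exact: measurable_funPTI.
- by apply: measurableX => //; exact: measurable_funPTI.
move=> w /=; rewrite !in_itv/= => Sz; split => //; apply/bigmax_leP;
  split => // i _.
by have [[k tk Sk]|[]//] := payoffP w; move: (lt_trans zt tk);
  rewrite -Sk ltNge Sz.
Qed.

Context (X_indep : independent_RVs X).

Lemma payoff_survival (x : R) : t <= x ->
  fine (cdf (max_reward X) t) * (1 - fine (cdf (max_reward X) x)) <=
  1 - fine (cdf S x).
Proof.
move=> tx.
have x0 : 0 <= x by exact: le_trans tx.
(* [A i] is the event that reward [i] exceeds [x] while all others stay at most [t]. *)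
pose B (i j : 'I_n) : set R :=
  if j == i then `]x, +oo[%classic else `]-oo, t]%classic.
pose A i := \bigcap_(j in [set: 'I_n]) (X j @^-1` B i j).
have mB i j : measurable (B i j) by rewrite /B; case: ifP.
have mA i : measurable (A i).
  by apply: fin_bigcap_measurable => // j _; exact: measurable_funPTI.
have PA i : P (A i) = (\prod_(j < n) P (X j @^-1` B i j))%E.
  by rewrite -X_indep.
have fE i : fine (P (A i)) =
    (1 - fine (cdf (X i) x)) * \prod_(j < n | j != i) fine (cdf (X j) t).
  rewrite PA (bigD1 i)//= {1}/B eqxx.
  have -> : X i @^-1` `]x, +oo[ = ~` (X i @^-1` `]-oo, x]).
    by rewrite preimage_setC setCitvl.
  rewrite probability_setC; last exact: measurable_funPTI.
  rewrite -[P _]/(cdf (X i) x) -[cdf (X i) x]fineK ?cdf_fin_num//.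
  rewrite (eq_bigr (fun j => (fine (cdf (X j) t))%:E)); last first.
    by move=> j ji; rewrite /B (negbTE ji) fineK ?cdf_fin_num.
  by rewrite prodEFin.
(* Inserting the missing factor [cdf (X i) t <= 1] completes the product to the cdf of the
   maximum. *)
have Age i : fine (cdf (max_reward X) t) * (1 - fine (cdf (X i) x)) <=
  fine (P (A i)).
  rewrite fE fine_cdf_max_reward// (bigD1 i)//= mulrC ler_wpM2l//.
    by rewrite subr_ge0; case/andP: (fine_cdf_itv01 (X i) x).
  rewrite ler_piMl//; last by case/andP: (fine_cdf_itv01 (X i) t).
  by apply: prodr_ge0 => j _; case/andP: (fine_cdf_itv01 (X j) t).
have tA : trivIset setT A.
  apply/trivIsetP => i j _ _ ij; apply/seteqP; split => // w [Ai Aj].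
  have := Ai i I; have := Aj i I;
    rewrite /B/= eqxx (negbTE ij)/= !in_itv/= andbT.
  by move=> it /(le_lt_trans tx); rewrite ltNge it.
pose U := \big[setU/set0]_(i < n) A i.
have UE w : U w -> exists i, A i w.
  rewrite /U; elim/big_ind : _ => [//|V W IHV IHW [/IHV|/IHW]//|i _ Ai].
  by exists i.
have mU : measurable U by exact: bigsetU_measurable.
have PU : fine (P U) = \sum_(i < n) fine (P (A i)).
  rewrite /U measure_bigsetU_ord// sum_fine//.
  by move=> i _; exact: fin_num_measure.
have US : (P U <= 1 - cdf S x)%E.
  rewrite -[cdf S x]/((P \x seed_law pol)%E (S @^-1` `]-oo, x])).
  rewrite -product_seed_law// -(@probability_setC _ _ _
    (P \x seed_law pol)%E); last exact: measurable_funPTI.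
  apply: le_measure; rewrite ?inE.
  - exact: measurableX.
  - by apply: measurableC; exact: measurable_funPTI.
  move=> w [/UE[i Ai] _] /=.
  rewrite in_itv/=; apply/negP; rewrite -ltNge.
  have xi : x < X i w.1 by have := Ai i I; rewrite /B/= eqxx/= in_itv/= andbT.
  (* On [A i] only reward [i] exceeds [t], so it is the accepted one whenever it arrives. *)
  have [[k tk ->]|[/(_ i) it _]] := payoffP w.
    have [->//|ki] := eqVneq k i.
    have := Ai k I; rewrite /B/= (negbTE ki)/= in_itv/=.
    by rewrite leNgt tk.
  by have := lt_le_trans (le_lt_trans tx xi) it; rewrite ltxx.
apply: (@le_trans _ _ (fine (P U))); last first.
  by rewrite -lee_fin EFinB !fineK ?cdf_fin_num// fin_num_measure.
(* After factoring out the cdf of the maximum at [t], it remains to compare the sum of the survivals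
   at [x] with the survival of the maximum. *)
rewrite PU (le_trans _ (ler_sum _ (fun i _ => Age i)))// -mulr_sumr.
rewrite ler_wpM2l//; first by case/andP: (fine_cdf_itv01 (max_reward X) t).
rewrite fine_cdf_max_reward//.
have -> : \prod_(i < n) fine (cdf (X i) x) =
    \prod_(i < n) (1 - (1 - fine (cdf (X i) x))).
  by apply: eq_bigr => i _; rewrite subKr.
apply: onem_prod_le_sum => i.
by have := fine_cdf_itv01 (X i) x; lra.
Qed.

End payoff.

(** * Guarantees *)

Section guarantee.
Context (R : realType) (alpha : R) (halpha : 0 < alpha <= 1).
Context (d : measure_display) (T : measurableType d) (P : probability T R).
Context (n : nat) (X : 'I_n -> {RV P >-> R}).
Context (X_ge0 : forall i w, 0 <= X i w).
Context (X_indep : independent_RVs X).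
Context (X_IFRA : forall i, continuous_recentered_IFRA (X i)).
Context (M_gt0 : (0 < lower_tail alpha (max_reward X))%E).
Context (M_fin : (lower_tail alpha (max_reward X) < +oo)%E).
Context (sigma : 'S_n).
Notation mu := (@lebesgue_measure R).
Notation g := (fun u : R => fine (quantile (max_reward X) u)).

(** Without rewards the maximum is constantly 0 and its lower tail vanishes. *)
Lemma rewards_nonempty : (0 < n)%N.
Proof.
rewrite lt0n; apply/negP => /eqP n0.
have c1 : cdf (max_reward X) 0 = 1%E.
  rewrite cdf_max_reward//; move: (X); rewrite n0 => Y; exact: big_ord0.
move: M_gt0; rewrite /lower_tail.
have -> : (\int[mu]_(u in `]0%R, alpha[) quantile (max_reward X) u = 0)%E.
  rewrite integral0_eq// => u /=; rewrite in_itv/= => /andP[u0 ua].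
  apply/eqP; rewrite eq_le quantile_ge0 ?andbT//; last exact: max_reward_ge0.
  apply: quantile_le; rewrite c1 lee_fin ltW// (lt_le_trans ua)//.
  by case/andP: halpha.
by rewrite ltxx.
Qed.

Lemma measurable_fine_quantile : measurable_fun setT g.
Proof. by apply: measurableT_comp => //; exact: measurable_quantile. Qed.

Lemma lower_tail_max_rewardE :
  lower_tail alpha (max_reward X) = (\int[mu]_(u in `]0%R, alpha[) (g u)%:E)%E.
Proof.
apply: eq_integral => u; rewrite inE/= in_itv/= => /andP[u0 ua].
rewrite max_reward_quantileE// u0 (lt_le_trans ua)//.
by case/andP: halpha.
Qed.

Lemma integrable_fine_quantile : mu.-integrable `]0, alpha[ (EFin \o g).
Proof.
apply/integrableP; split.
  by apply: measurable_funTS; apply/measurable_EFinP;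
    exact: measurable_fine_quantile.
have -> : (\int[mu]_(u in `]0%R, alpha[) `|(EFin \o g) u| =
    \int[mu]_(u in `]0%R, alpha[) (g u)%:E)%E.
  apply: eq_integral => u; rewrite inE/= in_itv/= => /andP[u0 ua].
  by rewrite ger0_norm// fine_ge0// quantile_ge0//; exact: max_reward_ge0.
by rewrite -lower_tail_max_rewardE.
Qed.

Lemma lower_tail_max_reward_Rintegral :
  lower_tail alpha (max_reward X) = (\int[mu]_(u in `]0, alpha[) g u)%:E.
Proof.
by rewrite lower_tail_max_rewardE fineK//;
  exact: (integrable_fin_num _ integrable_fine_quantile).
Qed.

Section policy_at_quantile.
Context (q : R) (hq : 0 < q < alpha) (t0 : 0 <= g q).
Notation S := (payoff X sigma (strict_policy n t0)).

Lemma cdf_max_reward_threshold : fine (cdf (max_reward X) (g q)) = q.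
Proof.
have [/andP[q0 qa] /andP[_ a1]] := (hq, halpha).
apply: cdf_max_reward_quantile => //; first exact: rewards_nonempty.
by rewrite -max_reward_quantileE// q0 (lt_le_trans qa).
Qed.

(** If [z < g q], the payoff cdf at [z] is at most the cdf of the maximum at the threshold, which is
    [q < u]. *)
Lemma threshold_le (u z : R) : q < u -> (u%:E <= cdf S z)%E -> g q <= z.
Proof.
move=> qu uz; rewrite leNgt; apply/negP => zt.
have := le_trans uz (cdf_payoff_le X sigma t0 zt).
by rewrite -[cdf _ _]fineK
  ?cdf_fin_num// cdf_max_reward_threshold lee_fin leNgt qu.
Qed.

Lemma quantile_payoff_ge_threshold (u : R) : q < u ->
  ((g q)%:E <= quantile S u)%E.
Proof. by move=> qu; apply: le_quantile => z; exact: threshold_le. Qed.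

(** If the payoff cdf at [z] reaches [u], then [q * (1 - F z) <= 1 - u] for the cdf [F] of the
    maximum, that is [F z >= r_cap u q]. *)
Lemma quantile_payoff_ge_cap (u : R) : q < u -> 0 < r_cap u q < 1 ->
  ((g (r_cap u q))%:E <= quantile S u)%E.
Proof.
move=> qu r01; have /andP[q0 _] := hq; apply: le_quantile => z uz.
rewrite -lee_fin -max_reward_quantileE//; apply: quantile_le.
have tz := threshold_le qu uz.
have := payoff_survival sigma t0 X_indep tz.
rewrite cdf_max_reward_threshold => h.
rewrite -[cdf _ _]fineK ?cdf_fin_num// lee_fin.
move: uz; rewrite -[cdf _ _]fineK ?cdf_fin_num// lee_fin => uz.
rewrite /r_cap lerBlDr -lerBlDl ler_pdivlMr// mulrC (le_trans h)//.
by rewrite lerD2l lerN2.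
Qed.

Lemma lower_tail_payoff_ge_step :
  ((g q * (alpha - q))%:E <= lower_tail alpha S)%E.
Proof.
have /andP[q0 qa] := hq.
apply: integral_ge_step => //; first by rewrite !ltW.
- exact: measurable_quantile.
- by move=> u /andP[u0 _]; apply: quantile_ge0 => //; exact: payoff_ge0.
- by move=> u /andP[qu _]; exact: quantile_payoff_ge_threshold.
Qed.

Lemma lower_tail_payoff_ge_cap : 1 - alpha <= q * (1 - q) ->
  (((1 - 2 * q) * g q + q * \int[mu]_(x in `]0, r_cap alpha q[) g x)%:E <=
   lower_tail alpha S)%E.
Proof.
move=> D; have [/andP[q0 qa] /andP[_ a1]] := (hq, halpha).
apply: (@integral_ge_cap _ g) => //.
- exact: IFRA_quantile_max_reward.
- exact: measurable_fine_quantile.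
- exact: integrable_fine_quantile.
- exact: measurable_quantile.
- by move=> u /andP[u0 _]; apply: quantile_ge0 => //; exact: payoff_ge0.
- by move=> u /andP[qu _]; exact: quantile_payoff_ge_threshold.
move=> u /andP[bu ua]; apply: quantile_payoff_ge_cap.
  by apply: le_lt_trans bu; nra.
(* Positivity comes from [1 - u < q * (1 - q) < q]. *)
rewrite /r_cap; apply/andP; split.
  by rewrite subr_gt0 ltr_pdivrMr// mul1r; nra.
by rewrite ltrBlDr ltrDl divr_gt0// subr_gt0 (lt_le_trans ua).
Qed.

End policy_at_quantile.

(** The loss [eps] covers suprema that may not be attained, over [q] for the cap bound and over
    thresholds for the envelope bound. *)
Lemma exists_policy_rho (eps : R) : 0 < eps ->
  exists pol : threshold_policy R n,
  (((rho alpha - eps) * \int[mu]_(u in `]0, alpha[) g u)%:E <=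
   lower_tail alpha (payoff X sigma pol))%E.
Proof.
move=> eps0; have /andP[a0 a1] := halpha.
set I := \int[mu]_(u in _) _.
have I0 : 0 < I by move: M_gt0; rewrite lower_tail_max_reward_Rintegral lte_fin.
have gI := IFRA_quantile_max_reward X_indep X_IFRA.
have g0 (u : R) : 0 < u < alpha -> 0 <= g u.
  by move=> /andP[u0 ua]; have [h _ _] := gI; apply: h;
    rewrite u0 (lt_le_trans ua).
have ig := integrable_fine_quantile.
(* When the target is nonpositive, any policy works; this also absorbs the degenerate default values
   below. *)
have trivial_case : rho alpha - eps <= 0 -> exists pol : threshold_policy R n,
    (((rho alpha - eps) * I)%:E <= lower_tail alpha (payoff X sigma pol))%E.
  move=> r0; exists (strict_policy n (lexx 0)).
  apply: (@le_trans _ _ 0%E); first by rewrite lee_fin mulr_le0_ge0// ltW.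
  apply: integral_ge0 => u /=; rewrite in_itv/= => /andP[u0 _].
  by apply: quantile_ge0 => //; exact: payoff_ge0.
move: trivial_case; rewrite /rho.
case: (leP (rho_env alpha) (rho_cap alpha)) => _.
  rewrite /rho_cap; case: asboolP => [D0|_]; last first.
    by apply; rewrite sub0r oppr_le0 ltW.
  (* [sup] is [0] on a set without a supremum. *)
  have [hs _|hs] := pselect (has_sup (G_cap alpha @` D_cap alpha)); last first.
    by apply; rewrite sup_out// sub0r oppr_le0 ltW.
  have [_ [q [hq q12 qD] <-] Gq] := sup_adherent eps0 hs.
  exists (strict_policy n (g0 _ hq)).
  apply: le_trans (lower_tail_payoff_ge_cap hq (g0 _ hq) qD).
  rewrite lee_fin; apply: le_trans (G_cap_le gI hq a1 q12 qD ig).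
  by rewrite ler_pM2r// ltW.
rewrite /rho_env /q_env.
case: xgetP => [q _ [/[dup] hq /andP[q0 qa] _]|_]; last first.
  (* With no solution, [q_env] is [0] and a division by zero makes [rho_env]
     vanish. *)
  by apply; rewrite subr0 ell0 mulr0 invr0 mulr0 addr0 divff ?gt_eqF// ln1 invr0
    sub0r oppr_le0 ltW.
move=> _.
set B := ln _ + _.
have B0 : 0 < B.
  rewrite /B ltr_pwDl//.
    rewrite ln_gt0// ltr_pdivlMr ?subr_gt0// mul1r.
    by rewrite ltrBlDr ltrDl.
  rewrite divr_ge0//; first by rewrite subr_ge0 Psi_le// !ltW.
  by rewrite mulr_ge0 ?subr_ge0 ?(ltW qa)// ell_ge0// (ltW q0) (lt_le_trans qa).
(* Either some level [v] already meets the target through the step bound, or all fall short and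
   [envelope_le] applies with the target as [c]. *)
have [[v hv hI]|no] := pselect (exists2 v : R, 0 < v < alpha &
    (B^-1 - eps) * I <= (alpha - v) * g v).
  exists (strict_policy n (g0 _ hv)).
  apply: le_trans (lower_tail_payoff_ge_step hv (g0 _ hv)).
  by rewrite lee_fin [leRHS]mulrC.
exfalso.
have := envelope_le gI hq a1 ig (c := (B^-1 - eps) * I).
rewrite -/B -/I => /(_ _) h.
have : I <= (B^-1 - eps) * I * B.
  apply: h => v hv; rewrite leNgt; apply/negP => h'; apply: no.
  by exists v => //; exact: ltW.
(* The envelope now reads [I <= (1 - eps * B) * I], impossible for positive [I], [eps] and [B]. *)
rewrite mulrAC mulrBl mulVf ?gt_eqF// mulrBl mul1r.
by rewrite leNgt ltrBlDr ltrDl mulr_gt0// mulr_gt0.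
Qed.

End guarantee.

Theorem theorem3 (R : realType) (alpha : R) (halpha : 0 < alpha <= 1)
    (d : measure_display) (T : measurableType d) (P : probability T R)
    (n : nat) (X : 'I_n -> {RV P >-> R})
    (X_ge0 : forall (i : 'I_n) (w : T), 0 <= X i w)
    (X_indep : independent_RVs X)
    (X_IFRA : forall i : 'I_n, continuous_recentered_IFRA (X i))
    (M_gt0 : (0 < lower_tail alpha (max_reward X))%E)
    (M_fin : (lower_tail alpha (max_reward X) < +oo)%E)
    (sigma : 'S_n) (eps : R) (heps : 0 < eps) :
  exists pol : threshold_policy R n,
    (CVaR alpha (payoff X sigma pol) / CVaR alpha (max_reward X) =
     lower_tail alpha (payoff X sigma pol) / lower_tail alpha (max_reward X))%E
    /\
    ((rho alpha - eps)%:E <=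
     lower_tail alpha (payoff X sigma pol) / lower_tail alpha (max_reward X))%E.
Proof.
have /andP[a0 a1] := halpha.
have ME := lower_tail_max_reward_Rintegral halpha M_fin.
have [pol hpol] :=
  exists_policy_rho halpha X_ge0 X_indep X_IFRA M_gt0 M_fin sigma heps.
exists pol; move: M_gt0 hpol; rewrite /CVaR ME lte_fin.
set I := \int[lebesgue_measure]_(u in _) _ => I0 hpol; split.
  (* Both divisors are positive reals, so [alpha] cancels among them; the payoff tail stays an
     extended real. *)
  rewrite !inver !gt_eqF//= -EFinM inver gt_eqF ?divr_gt0//.
  by rewrite -muleA -EFinM; congr (_ * _%:E)%E; field; rewrite !gt_eqF.
by rewrite inver gt_eqF//= lee_pdivlMr// -EFinM.
Qed.
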